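(* If $G$ is a split graph, then $\mathcal{E}(G)\geq 2\tau(G)$.
   Context: All graphs are finite, simple and undirected. The energy $\mathcal{E}(G)$ is the sum of the absolute values of all eigenvalues (with multiplicity) of the adjacency matrix $A(G)$. The vertex cover number $\tau(G)$ is the minimum cardinality of a set $X\subseteq V(G)$ such that every edge of $G$ has at least one endpoint in $X$. A graph is a split graph if its vertex set can be partitioned into two parts $V_1$ and $V_2$ such that one part induces a clique and the other is an independent set (edges between the two parts are arbitrary). *)

(* Defs.v *)
From mathcomp Require Import all_boot all_order all_algebra all_field.

Set Implicit Arguments.
Unset Strict Implicit.
Unset Printing Implicit Defensive.

Import Order.TTheory GRing.Theory Num.Theory.
Local Open Scope ring_scope.

Record sgraph := SGraph {
  vertex :> finType;
  edge : rel vertex;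
  edge_sym : symmetric edge;
  edge_irrefl : irreflexive edge
}.

Definition vertex_cover (G : sgraph) (X : {set G}) : bool :=
  [forall x, forall y, edge x y ==> (x \in X) || (y \in X)].

(* [set: G] is always a vertex cover, so this is a genuine minimum. *)
Definition vertex_cover_number (G : sgraph) : nat :=
  #|[arg min_(X < [set: G] | vertex_cover X) #|X|]%N|.

Definition clique (G : sgraph) (X : {set G}) : Prop :=
  {in X &, forall x y, x != y -> edge x y}.

Definition independent (G : sgraph) (X : {set G}) : Prop :=
  {in X &, forall x y, ~~ edge x y}.

(* As usual for split graphs, either part may be empty. *)
Definition split_graph (G : sgraph) : Prop :=
  exists V1 V2 : {set G},
    [/\ V1 :|: V2 = [set: G], [disjoint V1 & V2], clique V1 & independent V2].

(* Rows and columns follow the enumeration of the vertex type.  The entries are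
   0 and 1, so the whole complex spectrum lies in the field algC of algebraic
   complex numbers. *)
Definition adjacency_mx (G : sgraph) : 'M[algC]_#|G| :=
  \matrix_(i, j) (edge (enum_val i) (enum_val j))%:R.

(* All eigenvalues, repeated according to algebraic multiplicity. *)
Definition spectrum n (A : 'M[algC]_n) : seq algC :=
  sval (closed_field_poly_normal (char_poly A)).

Lemma spectrumP n (A : 'M[algC]_n) :
  char_poly A = \prod_(z <- spectrum A) ('X - z%:P).
Proof.
rewrite /spectrum; case: closed_field_poly_normal => r /= {1}->.
by rewrite (monicP (char_poly_monic A)) scale1r.
Qed.

Definition energy (G : sgraph) : algC :=
  \sum_(z <- spectrum (adjacency_mx G)) `|z|.

(* Main.v *)
(** For a Hermitian (indeed normal) matrix A and a unitary U, diagonalizing A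
    shows that |tr (A U)| is at most the sum of the |lambda| over the eigenvalues
    of A.  If the vertices of G are partitioned into r cliques, take for U the
    reflection 2 P - 1, where P averages over each clique; since a clique of size
    s contributes 2 (s - 1) to the trace, the energy is at least 2 (n - r).
    A split graph with clique part K and independent part I has such a partition
    with a vertex cover of size n - r.  If some v in K has no neighbour in I, use
    K and the singletons of I, with cover K minus v.  Otherwise attach every
    vertex of K to one of its neighbours in I, with cover K. *)

Require Import Defs.
From mathcomp Require Import all_boot all_order all_algebra all_field.

Set Implicit Arguments.
Unset Strict Implicit.
Unset Printing Implicit Defensive.

Import Order.TTheory GRing.Theory Num.Theory.
Local Open Scope ring_scope.
Local Open Scope sesquilinear_scope.

Lemma char_poly_conjugate (R : comUnitRingType) n (P A : 'M[R]_n) :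
  P \in unitmx -> char_poly (invmx P *m A *m P) = char_poly A.
Proof.
move=> P_unit; have PVP : map_mx polyC (invmx P) *m map_mx polyC P = 1%:M.
  by rewrite -map_mxM mulVmx // map_mx1.
rewrite /char_poly; suff -> : char_poly_mx (invmx P *m A *m P) =
    map_mx polyC (invmx P) *m char_poly_mx A *m map_mx polyC P.
  by rewrite !det_mulmx mulrAC -det_mulmx PVP det1 mul1r.
by rewrite /char_poly_mx mulmxBr mulmxBl !map_mxM mul_mx_scalar -scalemxAl PVP
           scalemx1.
Qed.

(** Similar matrices share their characteristic polynomial, and its factorization into monic linear
    factors is unique up to order. *)
Lemma spectrum_normal n (A : 'M[algC]_n) : A \is normalmx ->
  perm_eq (spectrum A) [seq spectral_diag A 0 i | i <- index_enum 'I_n].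
Proof.
move=> A_normal; apply: prod_XsubC_eq; rewrite -spectrumP big_map.
rewrite {1}(orthomx_spectralP A_normal) char_poly_conjugate ?spectral_unit //.
rewrite (char_poly_trig (diag_mx_is_trig _)).
by apply: eq_bigr => i _; rewrite mxE eqxx mulr1n.
Qed.

Lemma unitarymx_norm_le1 (C : numClosedFieldType) n (U : 'M[C]_n) i j :
  U \is unitarymx -> `|U i j| <= 1.
Proof.
move=> /unitarymxP/matrixP/(_ i i); rewrite !mxE eqxx => UU1.
have: `|U i j| ^+ 2 <= 1.
  rewrite -[leRHS]UU1 (bigD1 j) //= !mxE -normCK lerDl sumr_ge0 // => k _.
  by rewrite !mxE -normCK exprn_ge0.
by rewrite expr_le1.
Qed.

(** Cyclicity of the trace moves the diagonalizing [P] onto [U]: the trace becomes that of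
    [diag_mx d] times the unitary [P *m U *m invmx P], whose diagonal entries have modulus at most
    1. *)
Lemma trace_mul_unitary_le n (A U : 'M[algC]_n) :
    A \is normalmx -> U \is unitarymx ->
  `|\tr (A *m U)| <= \sum_(z <- spectrum A) `|z|.
Proof.
move=> A_normal U_unitary; set P := spectralmx A; set d := spectral_diag A.
have P_unitary : P \is unitarymx := spectral_unitarymx A.
rewrite (perm_big _ (spectrum_normal A_normal)) big_map /= -/d.
have -> : \tr (A *m U) = \tr (diag_mx d *m (P *m U *m invmx P)).
  rewrite {1}(orthomx_spectralP A_normal) -/P -/d -!mulmxA mxtrace_mulC.
  by rewrite !mulmxA.
have V_unitary : P *m U *m invmx P \is unitarymx.
  by rewrite invmx_unitary // !mul_unitarymx ?trmxC_unitary.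
apply: le_trans (ler_norm_sum _ _ _) _; apply: ler_sum => i _.
by rewrite mul_diag_mx mxE normrM ler_piMr // unitarymx_norm_le1.
Qed.

Section Reflection.

Variables (n : nat) (T : finType) (c : 'I_n -> T).

Definition class_size (t : T) : nat := #|[pred i | c i == t]|.

Lemma class_size_neq0 i : (class_size (c i))%:R != 0 :> algC.
Proof. by rewrite pnatr_eq0 -lt0n; apply/card_gt0P; exists i; rewrite inE. Qed.

Lemma sum_class (t : T) (a : algC) :
  \sum_(i | c i == t) a = a *+ class_size t.
Proof. by rewrite sumr_const. Qed.

Definition class_proj : 'M[algC]_n :=
  \matrix_(i, j) ((c i == c j)%:R / (class_size (c i))%:R).

Lemma class_proj_idem : class_proj *m class_proj = class_proj.
Proof.
apply/matrixP=> i k; rewrite !mxE.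
rewrite (bigID (fun j => c j == c i)) /= [X in _ + X]big1 ?addr0; last first.
  by move=> j /negPf cji; rewrite !mxE eq_sym cji !mul0r.
under eq_bigr => j /eqP cji do rewrite !mxE cji eqxx.
rewrite sum_class -[LHS]mulr_natr mul1r mulrC mulrA mulfV ?mul1r //.
exact: class_size_neq0.
Qed.

Lemma class_proj_trC : class_proj^t* = class_proj.
Proof.
apply/matrixP=> i j; rewrite !mxE rmorphM fmorphV !rmorph_nat eq_sym.
by case: eqP => [->|_] //; rewrite !mul0r.
Qed.

Definition class_reflection : 'M[algC]_n := class_proj *+ 2 - 1%:M.

(** The projection is Hermitian and idempotent, so the reflection is its own adjoint and squares to
    4P - 4P + 1 = 1. *)
Lemma class_reflection_unitary : class_reflection \is unitarymx.
Proof.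
apply/unitarymxP; rewrite /class_reflection.
have -> : (class_proj *+ 2 - 1%:M)^t* = class_proj *+ 2 - 1%:M.
  rewrite !linearB !linearMn /= trmx1 map_mxB map_mx1.
  by rewrite mulr2n map_mxD class_proj_trC.
rewrite mulmxBl mul1mx mulmxBr mulmx1 mulr2n mulmxDl !mulmxDr class_proj_idem.
by rewrite addrK subKr.
Qed.

(** A class of size s contributes s terms 1/s, hence 1 in total. *)
Lemma sum_class_size_inv :
  \sum_i (class_size (c i))%:R^-1 = #|codom c|%:R :> algC.
Proof.
rewrite (partition_big c (mem (codom c))) /=; last by move=> i _; apply: codom_f.
rewrite -sum1_card natr_sum; apply: eq_bigr => _ /codomP [i ->].
under eq_bigr => j /eqP -> do [].
by rewrite sum_class -[LHS]mulr_natr mulVf ?class_size_neq0.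
Qed.

End Reflection.

Lemma adjacency_mx_normal (G : sgraph) : adjacency_mx G \is normalmx.
Proof.
apply/normalmxP; suff -> : (adjacency_mx G)^t* = adjacency_mx G by [].
by apply/matrixP=> i j; rewrite !mxE rmorph_nat edge_sym.
Qed.

Lemma energy_clique_partition (G : sgraph) (T : finType) (c : G -> T) :
    (forall x y, x != y -> c x = c y -> edge x y) ->
  2%:R * (#|G|%:R - #|codom c|%:R) <= energy G.
Proof.
move=> c_clique; pose c' (i : 'I_#|G|) := c (enum_val i).
have codom_c' : #|codom c'| = #|codom c|.
  apply: eq_card => t; apply/codomP/codomP => [[i ->]|[x ->]].
    by exists (enum_val i).
  by exists (enum_rank x); rewrite /c' enum_rankK.
have := trace_mul_unitary_le (adjacency_mx_normal G)
          (class_reflection_unitary c').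
suff -> : \tr (adjacency_mx G *m class_reflection c') =
    2%:R * (#|G|%:R - #|codom c|%:R).
  by apply: le_trans; rewrite real_ler_norm // rpredM ?rpredB ?realn.
have row_sum i : \sum_(j | c' j == c' i) (class_size c' (c' j))%:R^-1 = 1 :> algC.
  under eq_bigr => j /eqP -> do [].
  by rewrite sum_class -[LHS]mulr_natr mulVf ?class_size_neq0.
have -> : \tr (adjacency_mx G *m class_reflection c') =
    \sum_i 2%:R * (1 - (class_size c' (c' i))%:R^-1).
  (* Expanding 1 as a row sum of the projection lets its term at [i] cancel the subtracted inverse;
     on the left the term at [i] vanishes since there are no loops. The terms with [j != i] are then
     compared one by one. *)
  apply: eq_bigr => i _; rewrite mxE -[X in X - _](row_sum i).
  rewrite (bigD1 i) //= [in RHS](bigD1 i) //=.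
  rewrite [X in X - _]addrC addrK !mxE edge_irrefl mul0r add0r.
  rewrite mulr_sumr big_mkcond [in RHS]big_mkcond /=; apply: eq_bigr => j _.
  case: (eqVneq j i) => [|ji]; rewrite ?andbF ?andbT // !mxE (negPf ji) subr0.
  case: eqP => [cji|_]; last by rewrite mul0r addr0 mulr0.
  have -> : edge (enum_val i) (enum_val j).
    by apply: c_clique; rewrite ?(inj_eq enum_val_inj) 1?eq_sym.
  by rewrite !mul1r -mulr2n mulr_natl.
by rewrite -mulr_sumr sumrB sum_class_size_inv codom_c' sumr_const card_ord.
Qed.

Lemma vertex_cover_number_le (G : sgraph) (X : {set G}) :
  vertex_cover X -> (vertex_cover_number G <= #|X|)%N.
Proof.
rewrite /vertex_cover_number; case: arg_minnP => [|Y _ minY]; last exact: minY.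
by apply/forallP=> x; apply/forallP=> y; rewrite !inE implybT.
Qed.

(** All labels lie outside [X], so there are at most n - |X| cliques and n - r is at least |X|. *)
Lemma energy_ge_cover (G : sgraph) (c : G -> G) (X : {set G}) :
    (forall x y, x != y -> c x = c y -> edge x y) ->
    vertex_cover X -> (forall x, c x \notin X) ->
  2%:R * (vertex_cover_number G)%:R <= energy G.
Proof.
move=> c_clique /vertex_cover_number_le tauX cNX.
apply: le_trans (energy_clique_partition c_clique); rewrite ler_wpM2l ?ler0n //.
rewrite lerBrDr -natrD ler_nat -(cardC X) leq_add // subset_leq_card //.
by apply/subsetP=> _ /codomP [x ->]; apply: cNX.
Qed.

Theorem theorem3p4 (G : sgraph) (hG : split_graph G) :
  (2%:R * (vertex_cover_number G)%:R <= energy G)%R.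
Proof.
case: hG => K [I [KIT disKI K_clique I_indep]].
have notK x : (x \notin K) = (x \in I).
  have := in_setT x; rewrite -KIT inE; case: (boolP (x \in K)) => //= xK _.
  by rewrite (disjointFr disKI xK).
have coverK : vertex_cover K.
  apply/forallP=> x; apply/forallP=> y; apply/implyP=> xy.
  rewrite -[_ || _]negbK negb_or !notK.
  by apply/negP=> /andP [xI yI]; have := I_indep x y xI yI; rewrite xy.
case: (boolP [exists v in K, [forall y in I, ~~ edge v y]]).
  case/exists_inP=> v vK /forall_inP v_isolated.
  (* [v] labels the whole clique [K]. Dropping it from the cover is safe: each neighbour of [v] lies
     in [K] and differs from [v]. *)
  apply: (@energy_ge_cover _ (fun x => if x \in K then v else x) (K :\ v)).
  - move=> x y xy; case: ifPn => xK; case: ifPn => yK e.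
    + exact: K_clique.
    + by rewrite -e vK in yK.
    + by rewrite e vK in xK.
    + by rewrite e eqxx in xy.
  - have coverKv x y : edge x y -> x \in K -> (x \in K :\ v) || (y \in K :\ v).
      move=> xy xK; rewrite !in_setD1 xK andbT.
      case: (eqVneq x v) xy => //= -> vy; rewrite -[y \in K]negbK notK.
      rewrite (contraTN (v_isolated y)) // andbT.
      by apply: contraTneq vy => ->; rewrite edge_irrefl.
    apply/forallP=> x; apply/forallP=> y; apply/implyP=> xy.
    have /forallP/(_ x)/forallP/(_ y)/implyP/(_ xy)/orP [xK|yK] := coverK.
      exact: coverKv.
    by rewrite orbC coverKv // edge_sym.
  - by move=> x; rewrite in_setD1; case: ifP => [_|->]; rewrite ?eqxx ?andbF.
rewrite negb_exists_in => /forall_inP dominated.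
(* For [x] in [K], [dominated] makes the pick succeed; the default [x] only makes [f] total. *)
pose f x := odflt x [pick y in I | edge x y].
have fP x : x \in K -> f x \in I /\ edge x (f x).
  move=> xK; rewrite /f; case: pickP => [y /andP [] //|none].
  have := dominated x xK; rewrite negb_forall_in => /exists_inP [y yI].
  by rewrite negbK => xy; have := none y; rewrite /= yI xy.
(* Each class is a vertex of [I] with the vertices of [K] attached to it: those are adjacent to it
   by [fP] and to each other within [K]. *)
apply: (@energy_ge_cover _ (fun x => if x \in K then f x else x) K) => //.
  move=> x y xy; case: ifPn => xK; case: ifPn => yK e.
  - exact: K_clique.
  - by rewrite -e; case: (fP x xK).
  - by rewrite e edge_sym; case: (fP y yK).
  - by rewrite e eqxx in xy.
by move=> x; case: ifPn => // xK; rewrite notK; case: (fP x xK).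
Qed.
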